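(* Let $(A,b)$ be an irreducible $s$-stage Runge-Kutta method with positive radius of absolute monotonicity, and consider the telescopic multirate GARK scheme with $M$ micro-steps that uses $(A,b)$ as base scheme for both the fast and the slow components, with coupling matrices $A^{\{\mathfrak f,\mathfrak s,\lambda\}},A^{\{\mathfrak s,\mathfrak f,\lambda\}}\in\mathbb R^{s\times s}$, $\lambda=1,\dots,M$, and all coefficients nonnegative. Suppose that for all $i,j=1,\dots,M$ the following hold: $$\mathrm{Inc}\left(A_M^2+\left(A^{\{\mathfrak f,\mathfrak s,i\}}A^{\{\mathfrak s,\mathfrak f,j\}}\right)_{i,j=1,\dots,M}\right)\le \mathrm{Inc}(A_M),$$ $$\mathrm{Inc}\left(\begin{bmatrix}A&0\\ b^T&0\end{bmatrix}^2+\begin{bmatrix}\sum_{\lambda=1}^MA^{\{\mathfrak s,\mathfrak f,\lambda\}}A^{\{\mathfrak f,\mathfrak s,\lambda\}}&0\\ \sum_{\lambda=1}^Mb^TA^{\{\mathfrak f,\mathfrak s,\lambda\}}&0\end{bmatrix}\right)\le \mathrm{Inc}\left(\begin{bmatrix}A&0\\ b^T&0\end{bmatrix}\right),$$ $$\mathrm{Inc}\left(\sum_{\lambda=1}^{i-1}\mathbf 1\,b^TA^{\{\mathfrak f,\mathfrak s,\lambda\}}+A\,A^{\{\mathfrak f,\mathfrak s,i\}}+A^{\{\mathfrak f,\mathfrak s,i\}}A\right)\le \mathrm{Inc}\left(A^{\{\mathfrak f,\mathfrak s,i\}}\right),$$ $$\mathrm{Inc}\left(\sum_{\lambda=j+1}^{M}A^{\{\mathfrak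 s,\mathfrak f,\lambda\}}\mathbf 1\,b^T+A^{\{\mathfrak s,\mathfrak f,j\}}A+A\,A^{\{\mathfrak s,\mathfrak f,j\}}\right)\le \mathrm{Inc}\left(A^{\{\mathfrak s,\mathfrak f,j\}}\right),$$ $$\mathrm{Inc}\left((M-j)\,b^T+b^TA+b^TA^{\{\mathfrak s,\mathfrak f,j\}}\right)\le \mathrm{Inc}(b^T).$$ Then the multirate GARK scheme is absolutely monotonic, i.e. it has a positive radius of absolute monotonicity: there exists $R>0$ such that the scheme is absolutely monotonic at every $r\in(0,R]$.
   Context: Incidence matrix: $\mathrm{Inc}(X)$ is the matrix with entries $1$ where $X$ has nonzero entries and $0$ where $X$ has zero entries; inequalities between matrices are componentwise. $\mathbf 1$ is the vector of ones. Telescopic multirate GARK scheme. For $y'=f^{\{\mathfrak s\}}(y)+f^{\{\mathfrak f\}}(y)$, macro-step $H$, micro-step $h=H/M$, slow stages $Y_i^{\{\mathfrak s\}}$ and fast stages $Y_i^{\{\mathfrak f,\lambda\}}$ ($i=1,\dots,s$, $\lambda=1,\dots,M$): $$Y_i^{\{\mathfrak s\}}=y_n+H\sum_j a_{i,j}f^{\{\mathfrak s\}}(Y_j^{\{\mathfrak s\}})+h\sum_{\lambda=1}^M\sum_j a^{\{\mathfrak s,\mathfrak f,\lambda\}}_{i,j}f^{\{\mathfrak f\}}(Y_j^{\{\mathfrak f,\lambda\}}),$$ $$Y_i^{\{\mathfrak f,\lambda\}}=y_n+h\sum_{l=1}^{\lambda-1}\sum_j b_jf^{\{\mathfrak f\}}(Y_j^{\{\mathfrak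 f,l\}})+H\sum_ja^{\{\mathfrak f,\mathfrak s,\lambda\}}_{i,j}f^{\{\mathfrak s\}}(Y_j^{\{\mathfrak s\}})+h\sum_ja_{i,j}f^{\{\mathfrak f\}}(Y_j^{\{\mathfrak f,\lambda\}}),$$ $$y_{n+1}=y_n+h\sum_{\lambda=1}^M\sum_ib_if^{\{\mathfrak f\}}(Y_i^{\{\mathfrak f,\lambda\}})+H\sum_ib_if^{\{\mathfrak s\}}(Y_i^{\{\mathfrak s\}}).$$ Its coefficients are collected in the square matrix of size $\hat s=Ms+s+1$ $$\widetilde{\mathbf A}=\begin{bmatrix}\frac1MA&\cdots&0&A^{\{\mathfrak f,\mathfrak s,1\}}&0\\ \vdots&\ddots&&\vdots&\vdots\\ \frac1M\mathbf 1b^T&\cdots&\frac1MA&A^{\{\mathfrak f,\mathfrak s,M\}}&0\\ \frac1MA^{\{\mathfrak s,\mathfrak f,1\}}&\cdots&\frac1MA^{\{\mathfrak s,\mathfrak f,M\}}&A&0\\ \frac1Mb^T&\cdots&\frac1Mb^T&b^T&0\end{bmatrix},$$ whose upper left $M\times M$ block part is block lower triangular with diagonal blocks $\frac1MA$ and all strictly lower blocks $\frac1M\mathbf 1b^T$. Absolute monotonicity. Let $r>0$ and $\widetilde{\mathbf R}=\mathrm{diag}\{M\,r\,\mathbf I_{Ms\times Ms},\ r\,\mathbf I_{s\times s},\ 1\}$. A scheme with $\widetilde{\mathbf A}\ge0$ is called absolutely monotonic at $r$ if (the inverse exists and) componentwise $$(\mathbf I+\widetilde{\mathbf A}\widetilde{\mathbf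 R})^{-1}\mathbf 1_{\hat s\times1}\ge0,\qquad (\mathbf I+\widetilde{\mathbf A}\widetilde{\mathbf R})^{-1}\widetilde{\mathbf A}\widetilde{\mathbf R}\ge0.$$ The radius of absolute monotonicity is the largest $\mathcal R\ge0$ such that the scheme is absolutely monotonic for every $r\in[0,\mathcal R]$. For the single-rate Runge-Kutta method $(A,b)$ the analogous notions are used with $\widetilde{\mathbf A}$ replaced by $\begin{bmatrix}A&0\\ b^T&0\end{bmatrix}\ge 0$ and $\widetilde{\mathbf R}$ replaced by $r\mathbf I$. Irreducible is meant in the standard sense of Runge-Kutta theory (no stages that do not influence the output, and no duplicate/equivalent stages). For an irreducible method with positive radius of absolute monotonicity one has $\mathrm{Inc}\left(\begin{bmatrix}A&0\\ b^T&0\end{bmatrix}^2\right)\le\mathrm{Inc}\left(\begin{bmatrix}A&0\\ b^T&0\end{bmatrix}\right)$. The matrix $A_M$, of size $Ms+1$, represents $M$ concatenated steps of the base method: $$A_M=\begin{bmatrix}A&0&\cdots&0&0\\ \mathbf 1b^T&A&\cdots&0&0\\ \vdots&&\ddots&&\vdots\\ \mathbf 1b^T&\mathbf 1b^T&\cdots&A&0\\ b^T&b^T&\cdots&b^T&0\end{bmatrix}.$$ In the first condition, the $Ms\times Ms$ matrix $(A^{\{\mathfrak f,\mathfrak s,i\}}A^{\{\mathfrak s,\mathfrak f,j\}})_{i,j=1,\dots,M}$ (with $(i,j)$ block $A^{\{\mathfrak f,\mathfrak s,i\}}A^{\{\mathfrak s,\mathfrak f,j\}}$) is extended by a zero last row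 and a zero last column so as to have the size of $A_M$. *)

(* Defs.v *)
From mathcomp Require Import all_boot all_order all_algebra.

Set Implicit Arguments.
Unset Strict Implicit.
Unset Printing Implicit Defensive.

Import Order.TTheory GRing.Theory Num.Theory.
Local Open Scope ring_scope.

Definition lemx (R : realFieldType) (m n : nat) (X Y : 'M[R]_(m, n)) : Prop :=
  forall i j, X i j <= Y i j.

Notation "X <=m Y" := (lemx X Y) (at level 70, no associativity) : ring_scope.

Definition Inc (R : realFieldType) (m n : nat) (X : 'M[R]_(m, n)) :
    'M[R]_(m, n) :=
  \matrix_(i, j) (X i j != 0)%:R.

Definition ones (R : realFieldType) (n : nat) : 'cV[R]_n := const_mx 1.
Arguments ones {R n}.

(* Dahlquist-Jeltsch reducibility: the stages in T do not influence the
   output. *)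
Definition DJ_reducible (R : realFieldType) (s : nat) (A : 'M[R]_s)
    (b : 'cV[R]_s) : Prop :=
  exists T : {set 'I_s},
    [/\ T != set0,
        forall j, j \in T -> b j 0 = 0
      & forall i j, i \notin T -> j \in T -> A i j = 0].

(* Hundsdorfer-Spijker reducibility: the stages within each class of P are
   equivalent, and P has fewer than s classes. *)
Definition S_reducible (R : realFieldType) (s : nat) (A : 'M[R]_s) : Prop :=
  exists P : {set {set 'I_s}},
    [/\ partition P [set: 'I_s],
        (#|P| < s)%N
      & forall S T : {set 'I_s}, S \in P -> T \in P ->
          forall i j, i \in S -> j \in S ->
            \sum_(k in T) A i k = \sum_(k in T) A j k].

Definition irreducible_rk (R : realFieldType) (s : nat) (A : 'M[R]_s)
    (b : 'cV[R]_s) : Prop :=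
  ~ DJ_reducible A b /\ ~ S_reducible A.

Definition abs_monotonic (R : realFieldType) (n : nat) (K D : 'M[R]_n) : Prop :=
  [/\ 0 <=m K,
      1%:M + K *m D \in unitmx,
      0 <=m invmx (1%:M + K *m D) *m ones
    & 0 <=m invmx (1%:M + K *m D) *m (K *m D)].

(* The radius of absolute monotonicity may be infinite; its positivity is the
   existence of some positive rho below which (am r) always holds. *)
Definition positive_radius (R : realFieldType) (am : R -> Prop) : Prop :=
  exists2 rho : R, 0 < rho & forall r : R, 0 < r <= rho -> am r.

Definition rk_mx (R : realFieldType) (s : nat) (A : 'M[R]_s) (b : 'cV[R]_s) :
    'M[R]_(s + 1) :=
  block_mx A 0 b^T 0.

Definition rk_abs_monotonic (R : realFieldType) (s : nat) (A : 'M[R]_s)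
    (b : 'cV[R]_s) (r : R) : Prop :=
  abs_monotonic (rk_mx A b) r%:M.

(* The index \sum_(i < M) s is M * s presented so that the library's block
   decompositions apply. *)
Definition concat_block (R : realFieldType) (s M : nat) (A : 'M[R]_s)
    (b : 'cV[R]_s) : 'M[R]_(\sum_(i < M) s) :=
  \mxblock_(i < M, j < M)
    (if i == j then A else if (j < i)%N then ones *m b^T else 0).

Definition concat_row (R : realFieldType) (s M : nat) (b : 'cV[R]_s) :
    'M[R]_(1, \sum_(i < M) s) :=
  \mxrow_(j < M) b^T.

Definition concat_mx (R : realFieldType) (s M : nat) (A : 'M[R]_s)
    (b : 'cV[R]_s) : 'M[R]_(\sum_(i < M) s + 1) :=
  block_mx (concat_block M A b) 0 (concat_row M b) 0.

Definition gark_mx (R : realFieldType) (s M : nat) (A : 'M[R]_s)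
    (b : 'cV[R]_s) (Afs Asf : 'I_M -> 'M[R]_s) :
    'M[R]_((\sum_(i < M) s + s) + 1) :=
  block_mx
    (block_mx (M%:R^-1 *: concat_block M A b) (\mxcol_(l < M) Afs l)
              (\mxrow_(l < M) (M%:R^-1 *: Asf l)) A)
    0
    (row_mx (M%:R^-1 *: concat_row M b) b^T)
    0.

Definition gark_scaling (R : realFieldType) (s M : nat) (r : R) :
    'M[R]_((\sum_(i < M) s + s) + 1) :=
  block_mx (block_mx (M%:R * r)%:M 0 0 r%:M) 0 0 1%:M.

Definition gark_abs_monotonic (R : realFieldType) (s M : nat) (A : 'M[R]_s)
    (b : 'cV[R]_s) (Afs Asf : 'I_M -> 'M[R]_s) (r : R) : Prop :=
  abs_monotonic (gark_mx A b Afs Asf) (gark_scaling s M r).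

(* Main.v *)
Require Import Defs.
From mathcomp Require Import all_boot all_order all_algebra.

Set Implicit Arguments.
Unset Strict Implicit.
Unset Printing Implicit Defensive.

Import Order.TTheory GRing.Theory Num.Theory.
Local Open Scope ring_scope.

(** Write the scaled matrix [K *m D] of the scheme as [r *: N].  In [N] the
    factors [1 / M] of the fast columns of [K] cancel against the factors [M]
    of the scaling, so that [N] is a fixed nonnegative matrix, independent of
    [r].  The five hypotheses on incidence matrices give, block by block, that
    [N *m N] vanishes wherever [N] does ([gark_core_sqr_supp]).

    This inclusion of supports is enough for any nonnegative matrix [N]
    ([small_scaling]).  Expanding formally,
    [(1 + r N)^-1 (r N) = r N - r^2 N^2 + ...]; where [N] is positive, the
    first term dominates for small [r], and where [N] is zero, so are all its
    powers.  To avoid the series, let [B := r *: N] with [r] so small that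
    [B] has row sums below 1 and [B *m B <= B].  Then
    [(1 - B^2) (1 + B)^-1 = 1 - B], and therefore both matrices in the
    definition of absolute monotonicity, [(1 + B)^-1 1] and [(1 + B)^-1 B],
    are sent by [1 - B^2] to nonnegative matrices, [1 - B 1] and [B - B^2].
    As [B^2] is nonnegative with row sums below 1, the operator [1 - B^2]
    reflects nonnegativity: this is the minimum principle
    [sub1_substochastic_reflects_ge0]. *)

(** * Nonnegative matrices with small row sums *)

Section Substochastic.
Variables (R : realFieldType) (n : nat).
Implicit Types B : 'M[R]_n.

Lemma mulmx_ge0 (m p q : nat) (X : 'M[R]_(m, p)) (Y : 'M[R]_(p, q)) :
  0 <=m X -> 0 <=m Y -> 0 <=m X *m Y.
Proof.
move=> X0 Y0 i j; rewrite !mxE; apply: sumr_ge0 => k _.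
by apply: mulr_ge0; [have := X0 i k | have := Y0 k j]; rewrite mxE.
Qed.

Definition substochastic B := 0 <=m B /\ forall i, \sum_j B i j < 1.

(** The minimum principle for M-matrices: at a row [i] where a column of [X]
    is minimal, [X i j >= (B X) i j >= (row sum of B) * X i j]. *)
Lemma sub1_substochastic_reflects_ge0 B (m : nat) (X : 'M[R]_(n, m)) :
  substochastic B -> 0 <=m (1%:M - B) *m X -> 0 <=m X.
Proof.
move=> [B0 B1] X0 k j.
case: (@Order.TotalTheory.arg_minP _ _ _ k predT (fun i => X i j)) => // i _ mini.
rewrite mxE; apply: le_trans (mini k isT).
have := X0 i j; rewrite mulmxBl mul1mx !mxE subr_ge0 => BXle.
have: (\sum_l B i l) * X i j <= X i j.
  apply: le_trans BXle; rewrite mulr_suml; apply: ler_sum => l _.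
  by apply: ler_wpM2l; [have := B0 i l; rewrite mxE | apply: mini].
by rewrite -subr_ge0 -{1}[X i j]mul1r -mulrBl pmulr_rge0 // subr_gt0.
Qed.

Lemma substochastic_mul B : substochastic B -> substochastic (B *m B).
Proof.
move=> [B0 B1]; split; first exact: mulmx_ge0.
move=> i; apply: le_lt_trans (B1 i).
under eq_bigr do rewrite mxE.
rewrite exchange_big /=; apply: ler_sum => k _.
rewrite -mulr_sumr -[leRHS]mulr1.
by apply: ler_wpM2l; [have := B0 i k; rewrite mxE | apply: ltW].
Qed.

Lemma sub1sqr_factor B : 1%:M - B *m B = (1%:M - B) *m (1%:M + B).
Proof.
by rewrite mulmxDr mulmx1 mulmxBl mul1mx addrA subrK.
Qed.

(** A kernel vector of [1 + B] is one of [1 - B^2], and so is its opposite; by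
    the minimum principle both are nonnegative. *)
Lemma add1_substochastic_unit B : substochastic B -> 1%:M + B \in unitmx.
Proof.
move=> /substochastic_mul sB2.
rewrite -unitmx_tr -row_free_unit -kermx_eq0.
set X := kermx _; have : (1%:M + B) *m X^T = 0.
  by rewrite -[1%:M + B]trmxK -trmx_mul mulmx_ker trmx0.
move=> EX0.
(* used for [c = 1] and [c = -1] *)
have EX (c : R) : 0 <=m c *: X^T.
  apply: sub1_substochastic_reflects_ge0 sB2 _.
  by rewrite -scalemxAr sub1sqr_factor -mulmxA EX0 mulmx0 scaler0.
apply/eqP/matrixP => i j; apply/eqP; rewrite mxE eq_le.
by have := EX 1 j i; have := EX (-1) j i; rewrite !mxE mul1r mulN1r oppr_ge0 => -> ->.
Qed.

(** Both inverses are handled by multiplying with [1 - B^2], which cancels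
    [(1 + B)^-1] and leaves the factor [1 - B]. *)
Lemma abs_monotonic_of_substochastic (K D : 'M[R]_n) :
  0 <=m K -> substochastic (K *m D) ->
  (K *m D) *m (K *m D) <=m K *m D ->
  abs_monotonic K D.
Proof.
set B := K *m D => K0 sB B2.
have Bu := add1_substochastic_unit sB.
have sB2 := substochastic_mul sB; have [B0 B1] := sB.
split=> //; rewrite -/B; clearbody B;
  apply: sub1_substochastic_reflects_ge0 sB2 _;
  rewrite sub1sqr_factor mulmxA mulmxK // mulmxBl mul1mx => i j; last first.
  by have := B2 i j; rewrite !mxE subr_ge0.
have := B1 i; rewrite !mxE subr_ge0 => /ltW; congr (_ <= _).
by apply: eq_bigr => k _; rewrite mxE mulr1.
Qed.

End Substochastic.

Lemma row_mx_ge0 (R : realFieldType) (m n1 n2 : nat)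
    (X1 : 'M[R]_(m, n1)) (X2 : 'M[R]_(m, n2)) :
  0 <=m X1 -> 0 <=m X2 -> 0 <=m row_mx X1 X2.
Proof.
move=> H1 H2 i j; rewrite [leLHS]mxE -[j]splitK; case: (split j) => j' /=.
  by rewrite row_mxEl; have := H1 i j'; rewrite mxE.
by rewrite row_mxEr; have := H2 i j'; rewrite mxE.
Qed.

Lemma block_mx_ge0 (R : realFieldType) (m1 m2 n1 n2 : nat)
    (X1 : 'M[R]_(m1, n1)) (X2 : 'M[R]_(m1, n2))
    (X3 : 'M[R]_(m2, n1)) (X4 : 'M[R]_(m2, n2)) :
  0 <=m X1 -> 0 <=m X2 -> 0 <=m X3 -> 0 <=m X4 ->
  0 <=m block_mx X1 X2 X3 X4.
Proof.
move=> H1 H2 H3 H4 i j; rewrite [leLHS]mxE -[i]splitK; case: (split i) => i' /=.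
  by rewrite col_mxEu; have := row_mx_ge0 H1 H2 i' j; rewrite mxE.
by rewrite col_mxEd; have := row_mx_ge0 H3 H4 i' j; rewrite mxE.
Qed.

(** * Inclusion of supports and small scalings *)

Definition supp_sub (R : realFieldType) (m n : nat) (X Y : 'M[R]_(m, n)) :=
  forall i j, Y i j = 0 -> X i j = 0.

Lemma Inc_le_supp (R : realFieldType) (m n : nat) (X Y : 'M[R]_(m, n)) :
  Inc X <=m Inc Y -> supp_sub X Y.
Proof.
move=> le i j Y0; have := le i j; rewrite !mxE Y0 eqxx /=.
by case: eqP => //= _; rewrite ler10.
Qed.

Lemma supp_sub_block (R : realFieldType) (m1 m2 n1 n2 : nat)
    (X1 Y1 : 'M[R]_(m1, n1)) (X2 Y2 : 'M[R]_(m1, n2))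
    (X3 Y3 : 'M[R]_(m2, n1)) (X4 Y4 : 'M[R]_(m2, n2)) :
  supp_sub (block_mx X1 X2 X3 X4) (block_mx Y1 Y2 Y3 Y4) <->
  [/\ supp_sub X1 Y1, supp_sub X2 Y2, supp_sub X3 Y3 & supp_sub X4 Y4].
Proof.
split=> [H | [H1 H2 H3 H4] i j].
  split=> i j; [have := H (lshift m2 i) (lshift n2 j)
    | have := H (lshift m2 i) (rshift n1 j)
    | have := H (rshift m1 i) (lshift n2 j)
    | have := H (rshift m1 i) (rshift n1 j)];
  by rewrite ?block_mxEul ?block_mxEur ?block_mxEdl ?block_mxEdr.
rewrite -[i]splitK -[j]splitK; case: (split i) => i'; case: (split j) => j' /=;
  rewrite ?block_mxEul ?block_mxEur ?block_mxEdl ?block_mxEdr;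
  [exact: H1 | exact: H2 | exact: H3 | exact: H4].
Qed.

Lemma supp_sub_row (R : realFieldType) (m n1 n2 : nat)
    (X1 Y1 : 'M[R]_(m, n1)) (X2 Y2 : 'M[R]_(m, n2)) :
  supp_sub X1 Y1 -> supp_sub X2 Y2 ->
  supp_sub (row_mx X1 X2) (row_mx Y1 Y2).
Proof.
move=> H1 H2 i j; rewrite -[j]splitK; case: (split j) => j' /=.
  by rewrite !row_mxEl; exact: H1.
by rewrite !row_mxEr; exact: H2.
Qed.

Lemma supp_sub_mxcol (R : realFieldType) (M s n : nat)
    (X Y : 'I_M -> 'M[R]_(s, n)) :
  (forall i, supp_sub (X i) (Y i)) ->
  supp_sub (\mxcol_(i < M) X i) (\mxcol_(i < M) Y i).
Proof. by move=> H i j; rewrite !mxE; apply: H. Qed.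

Lemma supp_sub_mxrow (R : realFieldType) (M s m : nat)
    (X Y : 'I_M -> 'M[R]_(m, s)) :
  (forall j, supp_sub (X j) (Y j)) ->
  supp_sub (\mxrow_(j < M) X j) (\mxrow_(j < M) Y j).
Proof. by move=> H i j; rewrite !mxE; apply: H. Qed.

(** The bound on [r] makes the row sums of [r *: N] at most
    [r * \sum N < 1]; it also gives [r N^2 <= N], because the sum [c] of the
    entrywise quotients [N^2 / N] satisfies [N^2 <= c N]: entries with [N = 0]
    have [N^2 = 0] and contribute [0 / 0 = 0]. *)
Lemma small_scaling (R : realFieldType) (n : nat) (N : 'M[R]_n) :
  0 <=m N -> supp_sub (N *m N) N ->
  exists2 rho : R, 0 < rho & forall r, 0 < r <= rho ->
    substochastic (r *: N) /\ (r *: N) *m (r *: N) <=m r *: N.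
Proof.
move=> N0 NN.
have N_ge0 i j : 0 <= N i j by have := N0 i j; rewrite mxE.
have q_ge0 i j : 0 <= (N *m N) i j / N i j.
  by apply: divr_ge0 => //; have := mulmx_ge0 N0 N0 i j; rewrite mxE.
pose a := \sum_i \sum_j N i j; pose c := \sum_i \sum_j (N *m N) i j / N i j.
have a_ge0 : 0 <= a by do 2 apply: sumr_ge0 => ? _.
have c_ge0 : 0 <= c by do 2 apply: sumr_ge0 => ? _.
have d_gt0 : 0 < a + c + 1 by rewrite ltr_wpDl // addr_ge0.
exists (a + c + 1)^-1; rewrite ?invr_gt0 // => r /andP[r0].
rewrite -[_^-1]mul1r ler_pdivlMr // !mulrDr mulr1 => r1.
have ra_ge0 : 0 <= r * a by apply: mulr_ge0 => //; apply: ltW.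
have rc_ge0 : 0 <= r * c by apply: mulr_ge0 => //; apply: ltW.
have ra1 : r * a < 1.
  by apply: lt_le_trans r1; rewrite -addrA ltrDl ltr_wpDl.
have rc1 : r * c <= 1.
  by apply: le_trans r1; rewrite addrAC lerDr addr_ge0 // ltW.
split; first split.
- by move=> i j; rewrite !mxE; apply: mulr_ge0 => //; apply: ltW.
- move=> i; apply: le_lt_trans ra1.
  under eq_bigr do rewrite mxE.
  rewrite -mulr_sumr; apply: ler_wpM2l; first exact: ltW.
  rewrite /a [leRHS](bigD1 i) //= lerDl.
  by do 2 apply: sumr_ge0 => ? _.
move=> i j; rewrite -scalemxAl -scalemxAr mxE [leRHS]mxE.
apply: ler_wpM2l; first exact: ltW.
rewrite mxE; have [Nz|Nz] := eqVneq (N i j) 0; first by rewrite NN // Nz mulr0.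
have Np : 0 < N i j by rewrite lt0r Nz N_ge0.
rewrite -[leRHS]mul1r -ler_pdivrMr // -mulrA.
apply: le_trans rc1; apply: ler_wpM2l; first exact: ltW.
rewrite /c [leRHS](bigD1 i) //= (bigD1 j) //= -addrA lerDl.
by apply: addr_ge0; do ?[apply: sumr_ge0 => ? _].
Qed.

(** * The telescopic scheme *)

(** The matrix that remains of [gark_mx] after scaling, up to the factor [r];
    see [gark_mx_scaling]. *)
Definition gark_core (R : realFieldType) (s M : nat) (A : 'M[R]_s)
    (b : 'cV[R]_s) (Afs Asf : 'I_M -> 'M[R]_s) :
    'M[R]_((\sum_(i < M) s + s) + 1) :=
  block_mx
    (block_mx (concat_block M A b) (\mxcol_(l < M) Afs l)
              (\mxrow_(l < M) Asf l) A)
    0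
    (row_mx (concat_row M b) b^T)
    0.

Section Telescopic.
Variables (R : realFieldType) (s M : nat) (A : 'M[R]_s) (b : 'cV[R]_s).
Variables (Afs Asf : 'I_M -> 'M[R]_s).

Lemma gark_mx_scaling (r : R) : (0 < M)%N ->
  gark_mx A b Afs Asf *m gark_scaling s M r = r *: gark_core A b Afs Asf.
Proof.
move=> M0; have M1 : M%:R * r * M%:R^-1 = r.
  by rewrite mulrAC divff ?mul1r // pnatr_eq0 -lt0n.
have row (m : nat) (X : 'I_M -> 'M[R]_(m, s)) :
    (M%:R * r) *: \mxrow_(l < M) (M%:R^-1 *: X l) = r *: \mxrow_(l < M) X l.
  by apply/matrixP => i j; rewrite !mxE mulrA M1.
rewrite /gark_mx /gark_scaling /gark_core mulmx_block mulmx_block mul_row_block.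
rewrite !mulmx0 !mul0mx !addr0 !add0r !mul_mx_scalar !scalerA M1 row.
by rewrite !scale_block_mx scale_row_mx !scaler0.
Qed.

Hypotheses (A_ge0 : 0 <=m A) (b_ge0 : 0 <=m b).
Hypotheses (Afs_ge0 : forall l, 0 <=m Afs l) (Asf_ge0 : forall l, 0 <=m Asf l).

Let Age i j : 0 <= A i j. Proof. by have := A_ge0 i j; rewrite mxE. Qed.
Let bge i j : 0 <= b i j. Proof. by have := b_ge0 i j; rewrite mxE. Qed.
Let Fge l i j : 0 <= Afs l i j.
Proof. by have := Afs_ge0 l i j; rewrite mxE. Qed.
Let Sge l i j : 0 <= Asf l i j.
Proof. by have := Asf_ge0 l i j; rewrite mxE. Qed.

Lemma concat_block_ge0 i j : 0 <= concat_block M A b i j.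
Proof.
rewrite mxE; case: ifP => // _; case: ifP => _; rewrite ?mxE //.
by apply: sumr_ge0 => k _; rewrite !mxE mul1r.
Qed.

Lemma gark_mx_ge0 : 0 <=m gark_mx A b Afs Asf.
Proof.
have Mi : 0 <= M%:R^-1 :> R by rewrite invr_ge0 ler0n.
apply: block_mx_ge0; try by move=> i j; rewrite lexx.
- apply: block_mx_ge0 => // i j; rewrite [leLHS]mxE [leRHS]mxE.
  + by rewrite mulr_ge0 // concat_block_ge0.
  + exact: Fge.
  + by rewrite mxE mulr_ge0.
- by apply: row_mx_ge0 => i j; rewrite !mxE // mulr_ge0.
Qed.

Lemma gark_core_ge0 : 0 <=m gark_core A b Afs Asf.
Proof.
apply: block_mx_ge0; try by move=> i j; rewrite lexx.
- apply: block_mx_ge0 => // i j; rewrite [leLHS]mxE.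
  + exact: concat_block_ge0.
  + by rewrite mxE.
  + by rewrite mxE.
- by apply: row_mx_ge0 => i j; rewrite !mxE.
Qed.

Hypothesis cond_ff :
  supp_sub (concat_mx M A b *m concat_mx M A b
            + block_mx (\mxblock_(i < M, j < M) (Afs i *m Asf j)) 0 0 0)
           (concat_mx M A b).
Hypothesis cond_ss :
  supp_sub (rk_mx A b *m rk_mx A b
            + block_mx (\sum_(l < M) Asf l *m Afs l) 0
                       (\sum_(l < M) b^T *m Afs l) 0)
           (rk_mx A b).
Hypothesis cond_fs : forall i : 'I_M,
  supp_sub (\sum_(l < M | (l < i)%N) ones *m b^T *m Afs l
            + A *m Afs i + Afs i *m A)
           (Afs i).
Hypothesis cond_sf : forall j : 'I_M,
  supp_sub (\sum_(l < M | (j < l)%N) Asf l *m ones *m b^T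
            + Asf j *m A + A *m Asf j)
           (Asf j).
Hypothesis cond_b : forall j : 'I_M,
  supp_sub ((M - j.+1)%:R *: b^T + b^T *m A + b^T *m Asf j) b^T.

(** The right-hand sides of this and the next lemma are the sums that occur in
    [cond_fs] and [cond_sf]. *)
Lemma concat_block_row_mul (p : nat) (X : 'I_M -> 'M[R]_(s, p)) (i : 'I_M) :
  \sum_(j < M)
     (if i == j then A else if (j < i)%N then ones *m b^T else 0) *m X j
  = \sum_(l < M | (l < i)%N) ones *m b^T *m X l + A *m X i.
Proof.
rewrite (bigD1 i) //= eqxx addrC; congr (_ + _).
rewrite (bigID (fun j : 'I_M => (j < i)%N)) /= [X in _ + X]big1 ?addr0.
  apply: eq_big => [j | j /andP[ji li]].
    by case: eqVneq => [-> | //]; rewrite ltnn.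
  by rewrite eq_sym (negPf ji) li.
by move=> j /andP[ji li]; rewrite eq_sym (negPf ji) (negPf li) mul0mx.
Qed.

Lemma mul_concat_block_col (p : nat) (X : 'I_M -> 'M[R]_(p, s)) (j : 'I_M) :
  \sum_(i < M)
     X i *m (if i == j then A else if (j < i)%N then ones *m b^T else 0)
  = \sum_(l < M | (j < l)%N) X l *m ones *m b^T + X j *m A.
Proof.
rewrite (bigD1 j) //= eqxx addrC; congr (_ + _).
rewrite (bigID (fun i : 'I_M => (j < i)%N)) /= [X in _ + X]big1 ?addr0.
  apply: eq_big => [i | i /andP[ij li]].
    by case: eqVneq => [-> | //]; rewrite ltnn.
  by rewrite (negPf ij) li mulmxA.
by move=> i /andP[ij li]; rewrite (negPf ij) (negPf li) mulmx0.
Qed.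

(** The blocks of the square are the sums bounded by the hypotheses: fast-fast
    by [cond_ff], fast-slow by [cond_fs], slow-fast by [cond_sf], slow-slow and
    the slow part of the output row by [cond_ss].  Only the fast part of the
    output row differs: it contains multiples [b^T 1 b^T] of [b^T], which
    vanish with [b^T], so that [cond_b] bounds the rest. *)
Lemma gark_core_sqr_supp :
  supp_sub (gark_core A b Afs Asf *m gark_core A b Afs Asf)
           (gark_core A b Afs Asf).
Proof.
move: cond_ff; rewrite /concat_mx mulmx_block add_block_mx.
rewrite !mulmx0 !mul0mx !addr0 => /supp_sub_block[ff _ _ _].
move: cond_ss; rewrite /rk_mx mulmx_block add_block_mx.
rewrite !mulmx0 !mul0mx !addr0 => /supp_sub_block[ss _ sb _].
rewrite /gark_core mulmx_block mulmx_block mul_row_block.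
rewrite !mulmx0 !mul0mx !addr0; apply/supp_sub_block; split=> //; last first.
  apply: supp_sub_row; last first.
    by rewrite mul_mxrow_mxcol addrC.
  rewrite /concat_row /concat_block mul_mxrow_mxblock mul_mxrow.
  rewrite -mxrowD; apply: supp_sub_mxrow => j i k b0.
  rewrite mul_concat_block_col.
  have := cond_b j b0; rewrite -addrA mxE [X in X + _]mxE b0 mulr0 add0r => bAS.
  rewrite -addrA mxE bAS addr0 summxE big1 // => l _.
  by rewrite mxE big1 // => q _; rewrite (ord1 q) -(ord1 i) b0 mulr0.
apply/supp_sub_block; split.
- by rewrite mul_mxcol_mxrow.
- rewrite /concat_block mul_mxblock_mxrow mxcol_mul -mxcolD.
  by apply: supp_sub_mxcol => i; rewrite concat_block_row_mul.
- rewrite /concat_block mul_mxrow_mxblock mul_mxrow -mxrowD.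
  by apply: supp_sub_mxrow => j; rewrite mul_concat_block_col.
- by rewrite mul_mxrow_mxcol addrC.
Qed.

End Telescopic.
Theorem theorem5p4 (R : realFieldType) (s M : nat)
    (A : 'M[R]_s) (b : 'cV[R]_s) (Afs Asf : 'I_M -> 'M[R]_s)
    (s_gt0 : (0 < s)%N) (M_gt0 : (0 < M)%N)
    (irrAb : irreducible_rk A b)
    (radAb : positive_radius (rk_abs_monotonic A b))
    (A_ge0 : 0 <=m A) (b_ge0 : 0 <=m b)
    (Afs_ge0 : forall l, 0 <=m Afs l) (Asf_ge0 : forall l, 0 <=m Asf l)
    (cond_ff :
       Inc (concat_mx M A b *m concat_mx M A b
            + block_mx (\mxblock_(i < M, j < M) (Afs i *m Asf j)) 0 0 0)
       <=m Inc (concat_mx M A b))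
    (cond_ss :
       Inc (rk_mx A b *m rk_mx A b
            + block_mx (\sum_(l < M) Asf l *m Afs l) 0
                       (\sum_(l < M) b^T *m Afs l) 0)
       <=m Inc (rk_mx A b))
    (cond_fs : forall i : 'I_M,
       Inc (\sum_(l < M | (l < i)%N) ones *m b^T *m Afs l
            + A *m Afs i + Afs i *m A)
       <=m Inc (Afs i))
    (cond_sf : forall j : 'I_M,
       Inc (\sum_(l < M | (j < l)%N) Asf l *m ones *m b^T
            + Asf j *m A + A *m Asf j)
       <=m Inc (Asf j))
    (* j ranges over 0, ..., M - 1, hence j.+1 *)
    (cond_b : forall j : 'I_M,
       Inc ((M - j.+1)%:R *: b^T + b^T *m A + b^T *m Asf j) <=m Inc (b^T)) :
  positive_radius (gark_abs_monotonic A b Afs Asf).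
Proof.
have [rho rho0 small] := small_scaling (gark_core_ge0 A_ge0 b_ge0 Afs_ge0 Asf_ge0)
  (gark_core_sqr_supp (Inc_le_supp cond_ff) (Inc_le_supp cond_ss)
     (fun i => Inc_le_supp (cond_fs i)) (fun j => Inc_le_supp (cond_sf j))
     (fun j => Inc_le_supp (cond_b j))).
exists rho => // r /small[subst sqr].
by apply: abs_monotonic_of_substochastic; rewrite ?gark_mx_scaling //; exact: gark_mx_ge0.
Qed.
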